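(* Let $S$ be a numerical semigroup with type $\mathrm{t}(S)=3$. Then $S$ is $\lambda$-minimal.
   Context: $\mathbb{N}=\{0,1,2,\dots\}$. A numerical set is a subset $T\subseteq\mathbb{N}$ with $0\in T$ and finite complement in $\mathbb{N}$. Its gaps are the elements of $\mathrm{G}(T)=\mathbb{N}\setminus T$; the largest gap is the Frobenius number $\mathrm{F}(T)$. A numerical semigroup is a numerical set closed under addition. The set of pseudo-Frobenius numbers of a numerical semigroup $S$ is $\mathrm{PF}(S)=\{P\in\mathbb{N}\setminus S: P+s\in S\text{ for all }s\in S\setminus\{0\}\}$, and the type of $S$ is $\mathrm{t}(S)=|\mathrm{PF}(S)|$. The enumeration $\lambda(T)$ of a numerical set $T$ is the integer partition whose Young diagram has as its profile (lower-right boundary) the lattice walk that, for $n=0,1,2,\dots,\mathrm{F}(T)$, takes a unit step right if $n\in T$ and a unit step up if $n\notin T$. Equivalently, the parts of $\lambda(T)$ are the numbers $\#\{u\in T: u<x\}$, one for each gap $x\in\mathrm{G}(T)$. The size $|\lambda|$ of a partition is the sum of its parts. The hook length of a box in the Young diagram of a partition $\lambda$ is the number of boxes to its right in the same row plus the number of boxes below it in the same column plus $1$; $\mathrm{H}(\lambda)$ is the set of all hook lengths of $\lambda$. For a numerical semigroup $S$, $\mathcal{P}(S)=\{\lambda:\mathrm{H}(\lambda)=\mathbb{N}\setminus S\}$; it is known that $\lambda(S)\in\mathcal{P}(S)$. $S$ is $\lambda$-minimal if $|\lambda(S)|\le|\lambda|$ for all $\lambda\in\mathcal{P}(S)$. 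*)

(* Defs.v *)
From mathcomp Require Import all_boot finmap.
From mathcomp Require Import boolp classical_sets cardinality.

Set Implicit Arguments.
Unset Strict Implicit.
Unset Printing Implicit Defensive.

Local Open Scope classical_set_scope.

Definition numerical_set (T : set nat) : Prop := T 0 /\ finite_set (~` T).

Definition numerical_semigroup (S : set nat) : Prop :=
  numerical_set S /\ forall a b, S a -> S b -> S (a + b).

Definition pseudo_frobenius (S : set nat) : set nat :=
  [set P | ~ S P /\ forall s, S s -> s <> 0 -> S (P + s)].

(* [fset_set A] is only meaningful for finite [A]; pseudo-Frobenius numbers are
   gaps, so they are finitely many when [S] is a numerical semigroup. *)
Definition semigroup_type (S : set nat) : nat :=
  #|` fset_set (pseudo_frobenius S)|%fset.

(* A partition is the weakly decreasing sequence of its positive parts; the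
   boxes of its Young diagram are the pairs (i, j) (row i from the top, column j
   from the left, both counted from 0) such that j < nth 0 la i. *)
Definition is_partition (la : seq nat) : bool :=
  sorted geq la && (0 \notin la).

Definition psize (la : seq nat) : nat := sumn la.

Definition in_diagram (la : seq nat) (i j : nat) : bool := j < nth 0 la i.

Definition arm (la : seq nat) (i j : nat) : nat := nth 0 la i - j.+1.

Definition leg (la : seq nat) (i j : nat) : nat :=
  count (fun r => j < r) (drop i.+1 la).

Definition hook_length (la : seq nat) (i j : nat) : nat :=
  (arm la i j + leg la i j).+1.

Definition hook_set (la : seq nat) : set nat :=
  [set h | exists i j, in_diagram la i j /\ h = hook_length la i j].

(* The profile walk runs from the bottom left to the top right of the diagram:
   its up-step at the gap x is the right end of a row whose length is the number
   of right-steps already taken. Larger gaps hence give higher rows, which is why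
   the gaps are listed in decreasing order. *)
Definition enumeration (T : set nat) : seq nat :=
  [seq count (fun u => u \in T) (iota 0 x) | x <- sort geq (fset_set (~` T))].

Definition hook_partitions (S : set nat) : set (seq nat) :=
  [set la | is_partition la /\ hook_set la = ~` S].

Definition lambda_minimal (S : set nat) : Prop :=
  forall la, hook_partitions S la -> psize (enumeration S) <= psize la.

(* Main.v *)
Require Import Defs.
From mathcomp Require Import all_boot finmap.
From mathcomp Require Import boolp classical_sets cardinality.
From mathcomp Require Import zify.

Set Implicit Arguments.
Unset Strict Implicit.
Unset Printing Implicit Defensive.

(** A partition is determined by the set [beta] of its first-column hook
    lengths; let [T] be the complement of that set. The hook lengths are exactly
    the differences [x - u] with [u < x], [u] in [T] and [x] not in [T], so
    the hook set is the complement of [S] precisely when [S] is the stabilizer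
    of [T] under translation; and the boxes of the diagram correspond to the
    pairs [(u, x)] themselves, so the size of the partition is the number of
    these pairs. The claim becomes: among all numerical sets [T] with stabilizer
    [S], the set [S] has the fewest pairs.

    Suppose first that [T] contains at most one pseudo-Frobenius number [p] of
    [S]. Every [v] in [T] but not in [S] lies below some pseudo-Frobenius
    number, in the order where differences are in [S]; as [T] absorbs [S], that
    number is in [T], so it is [p]. Since [p] does not stabilize [T], there is
    [w] in [T] with [w + p] outside [T], and above this gap a pseudo-Frobenius
    number [z] outside [T] with [z - p] in [T]. Then [z - v], being
    [(z - p) + (p - v)], is in [T] for all such [v], and not in [S] because [z]
    is not in [T]. The reflection at [z] is now an injection: a pair [(u, x)] of
    [S] is kept when [x] is a gap of [T], and sent to [(z - x, z - u)] otherwise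
    ([cells_reflection], [cells_le_of_one_pseudoFrob]).

    When the type is three, the pseudo-Frobenius numbers are [p <= q] and the
    Frobenius number [F], and [F] is never in [T]. The remaining case is that
    [p] and [q] are both in [T]. The conjugate partition corresponds to the
    dual set, consisting of the [x] with [F - x] not in [T]; it has the same
    stabilizer and the same number of pairs. Since [q] does not stabilize [T]
    and only [F] lies above [q], [F - q] is in [T], so [q] is not in the dual
    set and the first case applies to it ([cells_le_of_type3]). *)

(** * Numerical sets with a given stabilizer *)

Section Semigroup.

Variables (S : pred nat) (F : nat).
Hypothesis S0 : S 0.
Hypothesis SD : forall a b, S a -> S b -> S (a + b).
Hypothesis SF : ~~ S F.
Hypothesis S_gtF : forall x, F < x -> S x.

Definition pseudoFrob (z : nat) : Prop :=
  ~~ S z /\ forall s, S s -> s <> 0 -> S (z + s).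

Lemma gap_le x : ~~ S x -> x <= F.
Proof. by apply: contraNleq => /S_gtF. Qed.

(** Pseudo-Frobenius numbers are the maximal gaps for the order whose
    differences lie in [S], and the gaps are bounded by [F]. *)
Lemma gap_below_pseudoFrob x :
  ~~ S x -> exists2 e, S e & pseudoFrob (x + e).
Proof.
have [n] := ubnP (F - x); elim: n x => // n IHn x leFx nSx.
have [PFx|nPFx] := pselect (pseudoFrob x); first by exists 0; rewrite ?addn0.
have [s [Ss s_neq0 nSxs]] : exists s, [/\ S s, s <> 0 & ~~ S (x + s)].
  apply: contrapT => nex; apply: nPFx; split=> // s Ss s_neq0.
  by apply: contrapT => /negP nSxs; apply: nex; exists s.
have le_xs := gap_le nSxs.
have [|e Se PFe] := IHn (x + s) _ nSxs; first by lia.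
by exists (s + e); [exact: SD | rewrite addnA].
Qed.

(** The stabilizer of [T] under translation is [S]. Cofiniteness of [T] follows,
    since [T] contains [S]. *)
Definition associated (T : pred nat) : Prop :=
  T 0 /\ forall n, S n <-> forall t, T t -> T (t + n).

(** The boxes of the Young diagram whose profile is the walk of [T]: a box is the
    meeting of a column, that is a step right at [c.1], with a row, that is a later
    step up at [c.2]. *)
Definition cells (T : pred nat) : {set 'I_F.+1 * 'I_F.+1} :=
  [set c : 'I_F.+1 * 'I_F.+1 | [&& c.1 < c.2, T c.1 & ~~ T c.2]].

Section Associated.

Variable T : pred nat.
Hypothesis T_assoc : associated T.

Lemma assoc_addr t s : T t -> S s -> T (t + s).
Proof. by move=> Tt Ss; apply: (iffLR (T_assoc.2 s)). Qed.

Lemma assoc_sub s : S s -> T s.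
Proof. by move=> Ss; rewrite -[s]add0n; apply: assoc_addr => //; case: T_assoc. Qed.

Lemma assoc_escape n : ~~ S n -> exists2 t, T t & ~~ T (t + n).
Proof.
move=> nSn; apply: contrapT => nex; move/negP: nSn; apply.
apply/T_assoc.2 => t Tt; apply: contrapT => /negP nT.
by apply: nex; exists t.
Qed.

Lemma assoc_gap x : ~~ T x -> ~~ S x.
Proof. exact/contraNN/assoc_sub. Qed.

(** [F] does not stabilize [T], but every [t + F] with [t > 0] is beyond all
    gaps, so the failure occurs at [t = 0]. *)
Lemma assoc_frob : ~~ T F.
Proof.
have [t Tt nT] := assoc_escape SF.
have := gap_le (assoc_gap nT); case: t Tt nT => [|t] Tt nT //; lia.
Qed.

(** As [T] absorbs [S], if [z] is missing from [T] then so is [z - s] for every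
    [s] in [S] with [s <= z]. So a pair [(s, v)] counted for [S] but not for [T],
    because [v] is in [T], is traded for [(z - v, z - s)], which is counted for
    [T] but not for [S], because its first entry is not in [S]. *)
Lemma cells_reflection z : ~~ T z ->
    (forall v, T v -> ~~ S v -> v <= z /\ T (z - v)) ->
  #|cells S| <= #|cells T|.
Proof.
move=> nTz Vz; have le_zF := gap_le (assoc_gap nTz).
pose f (c : 'I_F.+1 * 'I_F.+1) : 'I_F.+1 * 'I_F.+1 :=
  if T c.2 then (inord (z - c.2), inord (z - c.1)) else c.
have V_refl v : T v -> ~~ S v -> ~~ S (z - v).
  move=> Tv nSv; have [le_vz _] := Vz v Tv nSv.
  by apply: contra nTz => Szv; rewrite -(subnKC le_vz) assoc_addr.
have f_inj : {in cells S &, injective f}.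
  move=> [u x] [u' x']; rewrite !inE /f /=.
  move=> /and3P[lt_ux Su nSx] /and3P[lt_ux' Su' nSx'].
  have [Tx|nTx] := boolP (T x); have [Tx'|nTx'] := boolP (T x') => //.
  - have [le_xz _] := Vz _ Tx nSx; have [le_xz' _] := Vz _ Tx' nSx'.
    case=> /(congr1 val) /= + /(congr1 val) /=; rewrite !inordK; try lia.
    by move=> eqx equ; congr pair; apply: val_inj => /=; lia.
  - case=> eqx _; case/negP: (V_refl _ Tx nSx).
    by move: Su'; rewrite -eqx inordK //; lia.
  - case=> eqx _; case/negP: (V_refl _ Tx' nSx').
    by move: Su; rewrite eqx inordK //; lia.
rewrite -(card_in_imset f_inj); apply/subset_leq_card/fintype.subsetP => c /imsetP[[u x] + ->] {c}.
rewrite inE /= => /and3P[lt_ux Su nSx]; rewrite /f /=.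
have [Tx|nTx] := boolP (T x); last by rewrite inE /= lt_ux nTx assoc_sub.
have [le_xz Tzx] := Vz _ Tx nSx.
rewrite inE /= !inordK; try lia.
rewrite Tzx; apply/and3P; split=> //; first by lia.
apply: contra nTz => Tzu; rewrite -(@subnK u z) ?assoc_addr //; lia.
Qed.

(** Everything in [T] outside [S] lies below [p], and [p] can be reflected into
    [T] at a pseudo-Frobenius number [z] missing from [T]; adding the elements
    [p - v] of [S] carries the reflection from [p] to each [v]. *)
Lemma cells_le_of_one_pseudoFrob p :
    (forall z, pseudoFrob z -> T z -> z = p) ->
  #|cells S| <= #|cells T|.
Proof.
move=> onep.
have V_below v : T v -> ~~ S v -> exists2 e, S e & v + e = p /\ pseudoFrob p.
  move=> Tv nSv; have [e Se PFe] := gap_below_pseudoFrob nSv.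
  have def_p := onep _ PFe (assoc_addr Tv Se).
  by exists e => //; rewrite -def_p.
have [[v Tv nSv]|noV] := pselect (exists2 v, T v & ~~ S v); last first.
  suff eqTS : T =1 S by apply/subset_leq_card/fintype.subsetP => c; rewrite !inE !eqTS.
  move=> x; apply/idP/idP => [Tx|/assoc_sub//].
  by apply: contrapT => /negP nSx; apply: noV; exists x.
have [d Sd [def_p [nSp _]]] := V_below v Tv nSv.
have Tp : T p by rewrite -def_p assoc_addr.
(* [p] lies in [T] but not in its stabilizer; a pseudo-Frobenius number above
   the gap [w + p] cannot be [p] itself, hence is missing from [T]. *)
have [w Tw nTwp] := assoc_escape nSp.
have [e Se PFz] := gap_below_pseudoFrob (assoc_gap nTwp).
set z := w + p + e in PFz.
have nTz : ~~ T z.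
  apply/negP=> Tz; have := onep _ PFz Tz; rewrite /z => eqp.
  by have w0 : w = 0 by [lia]; rewrite w0 add0n Tp in nTwp.
apply: (cells_reflection nTz) => u Tu nSu.
have [c Sc [def_p' _]] := V_below u Tu nSu.
split; first by rewrite /z; lia.
have -> : z - u = w + (e + c) by rewrite /z; lia.
by rewrite assoc_addr // SD.
Qed.

(** The numerical set of the conjugate partition: reversing the profile walk
    exchanges its steps right and its steps up. *)
Definition dual : pred nat := fun x => (F < x) || ~~ T (F - x).

Lemma dual_assoc : associated dual.
Proof.
have T_gtF x : F < x -> T x by move/S_gtF/assoc_sub.
split=> [|n]; first by rewrite /dual subn0 assoc_frob orbT.
split=> [Sn t|stab].
  rewrite /dual; case: ltnP => [lt_Ft _|le_tF nT]; first by apply/orP; left; lia.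
  case: ltnP => //= le_tnF; apply: contra nT => TF.
  have -> : F - t = F - (t + n) + n by lia.
  exact: assoc_addr.
apply: contrapT => /negP /assoc_escape[t Tt nT].
have le_tnF : t + n <= F by rewrite leqNgt; apply: contra nT => /T_gtF.
have := stab (F - (t + n)); rewrite /dual.
rewrite subKn // nT orbT => /(_ isT).
have -> : F - (t + n) + n = F - t by lia.
rewrite subKn; last by lia.
by rewrite Tt orbF; lia.
Qed.

Lemma card_cells_dual : #|cells dual| = #|cells T|.
Proof.
pose f (c : 'I_F.+1 * 'I_F.+1) := (rev_ord c.2, rev_ord c.1).
have fK : involutive f by move=> [u x]; rewrite /f /= !rev_ordK.
rewrite -(card_imset _ (inv_inj fK)); apply: eq_card => c.
rewrite -{1}[c]fK (mem_imset _ _ (inv_inj fK)) !inE /dual /=.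
case: c => u x /=; have := ltn_ord u; have := ltn_ord x; rewrite !ltnS => le_x le_u.
rewrite !subSS !subKn // !ltnNge !leq_subr /= negbK [~~ T x && _]andbC.
by congr (~~ _ && _); lia.
Qed.

End Associated.

(** If [p <= q] are both in [T], a pseudo-Frobenius number above a gap [w + q]
    exceeds both, so it is [F]; hence [F - q] is in [T] and [q] is not in the
    dual set, to which the case of a single pseudo-Frobenius number applies. *)
Lemma cells_le_of_type3 p q (T : pred nat) : associated T ->
    (forall z, pseudoFrob z -> [\/ z = p, z = q | z = F]) ->
  #|cells S| <= #|cells T|.
Proof.
move=> T_assoc.
wlog le_pq : p q / p <= q => [wlog_pq|PFpq].
  have [/wlog_pq//|/ltnW/wlog_pq + PFpq] := leqP p q.
  by apply=> z /PFpq []; [constructor 2 | constructor 1 | constructor 3].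
have nTF := assoc_frob T_assoc.
have [Tp|nTp] := boolP (T p); last first.
  apply: (@cells_le_of_one_pseudoFrob _ T_assoc q) => z /PFpq[->|//|->].
    by rewrite (negPf nTp).
  by rewrite (negPf nTF).
have [Tq|nTq] := boolP (T q); last first.
  apply: (@cells_le_of_one_pseudoFrob _ T_assoc p) => z /PFpq[//|->|->].
    by rewrite (negPf nTq).
  by rewrite (negPf nTF).
have D_assoc := dual_assoc T_assoc; rewrite -(card_cells_dual T).
apply: (cells_le_of_one_pseudoFrob D_assoc (p := p)) => z PFz.
have nDF := assoc_frob D_assoc.
have PFcases := PFpq z PFz; case: PFcases PFz => [//|->|->] [nSz _]; last by rewrite (negPf nDF).
have [w Tw nTwq] := assoc_escape T_assoc nSz.
have w_gt0 : 0 < w by case: w Tw nTwq => // _; rewrite add0n Tq.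
have [e Se PFe] := gap_below_pseudoFrob (assoc_gap T_assoc nTwq).
have def_F : w + q + e = F by case: (PFpq _ PFe) => //; lia.
rewrite /dual -def_F ltnNge.
have -> : w + q + e - q = w + e by lia.
by rewrite (assoc_addr T_assoc Tw Se) orbF; lia.
Qed.

Lemma sum_gaps_cells (T : pred nat) :
  \sum_(x <- iota 0 F.+1 | ~~ T x) count T (iota 0 x) = #|cells T|.
Proof.
transitivity (\sum_(x < F.+1 | ~~ T x) \sum_(u < F.+1 | (u < x) && T u) 1).
  have iotaE n : iota 0 n = index_iota 0 n by rewrite /index_iota subn0.
  rewrite iotaE big_mkord; apply: eq_bigr => x _.
  rewrite -sum1_count iotaE big_mkord.
  rewrite (big_ord_widen_cond F.+1 T (fun=> 1)) 1?ltnW ?ltn_ord //.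
  by apply: eq_bigl => u; rewrite andbC.
rewrite pair_big_dep sum1_card -(card_imset _ (can_inj (@swap_pairK _ _))).
apply: eq_card => c; apply/imsetP/idP => [[[x u]]|].
  by move=> xuP ->; move: xuP; rewrite !inE /= => /and3P[-> -> ->].
rewrite inE => /and3P[lt_c T1 T2]; exists (c.2, c.1); last by case: c {lt_c T1 T2}.
by rewrite unfold_in /= lt_c T1 T2.
Qed.

End Semigroup.

(** * First-column hook lengths of a partition *)

(** The hook lengths of the boxes of the first column, which are the
    positions of the up-steps of the profile. *)
Fixpoint beta (la : seq nat) : seq nat :=
  if la is a :: l then a + size l :: beta l else [::].

(** The position in the profile walk of the step right below column [j]: it
    comes after [j] other steps right and after the up-steps of the rows that end
    to the left of column [j]. *)
Definition step_right (la : seq nat) (j : nat) : nat :=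
  j + count (fun r => r <= j) la.

Lemma path_geq_all a l : path geq a l = all (geq a) l && sorted geq l.
Proof. by rewrite path_sortedE // => x y z /= xy yz; apply: leq_trans xy. Qed.

Lemma beta_lt a l x : path geq a l -> x \in beta l -> x < a + size l.
Proof.
elim: l a => //= b l IHl a /andP[le_ba /IHl lt_l].
by rewrite inE => /orP[/eqP->|/lt_l]; lia.
Qed.

Lemma beta_uniq la : sorted geq la -> uniq (beta la).
Proof.
elim: la => //= a l IHl pal; rewrite IHl ?(path_sorted pal) // andbT.
by apply/negP=> /(beta_lt pal); rewrite ltnn.
Qed.

Lemma size_beta la : size (beta la) = size la.
Proof. by elim: la => //= a l ->. Qed.

Lemma beta_gt0 la : 0 \notin la -> 0 \notin beta la.
Proof. by elim: la => //= a l IHl; rewrite !inE !negb_or => /andP[a0 /IHl->]; lia. Qed.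

Lemma step_right_large a l j : path geq a l -> a <= j ->
  step_right l j = j + size l.
Proof.
rewrite path_geq_all => /andP[/allP le_l _] le_aj; congr (_ + _).
by apply/eqP; rewrite -all_count; apply/allP => r /le_l /= ra; apply: leq_trans le_aj.
Qed.

Lemma step_right_small a l j : j < a -> step_right l j < a + size l.
Proof. by have := count_size (fun r => r <= j) l; rewrite /step_right; lia. Qed.

(** Each step of the profile goes either right or up. A new first row [a] only
    delays the steps right from column [a] on, making room for its own up-step. *)
Lemma notin_betaP la u : sorted geq la ->
  u \notin beta la <-> exists j, u = step_right la j.
Proof.
elim: la u => [|a l IHl] u /=.
  by rewrite /step_right; split=> // _; exists u; rewrite addn0.
move=> pal; have {}IHl := IHl _ (path_sorted pal).
rewrite inE negb_or; split=> [/andP[neq_u /IHl[j def_u]]|[j ->]].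
  have [lt_ja|le_aj] := ltnP j a.
    by exists j; rewrite def_u /step_right /= leqNgt lt_ja.
  move: neq_u; rewrite def_u (step_right_large pal le_aj) => neq_j.
  have le_aj1 : a <= j.-1 by lia.
  exists j.-1; have := step_right_large pal le_aj1; rewrite /step_right /= le_aj1.
  by lia.
have [lt_ja|le_aj] := ltnP j a.
  have -> : step_right (a :: l) j = step_right l j.
    by rewrite /step_right /= leqNgt lt_ja.
  apply/andP; split; last by apply/IHl; exists j.
  by rewrite neq_ltn step_right_small.
have -> : step_right (a :: l) j = j.+1 + size l.
  by have := step_right_large pal le_aj; rewrite /step_right /= le_aj; lia.
apply/andP; split; first by lia.
by apply/negP=> /(beta_lt pal); lia.
Qed.

(** The hook of the box [(0, j)] follows the profile from the step right below
    column [j] to the last up-step, at [a + size l]; the hooks of the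
    lower rows do not involve the first row. *)
Lemma hook_set_cons a l h :
  hook_set (a :: l) h <->
  (exists2 j, j < a & step_right l j + h = a + size l) \/ hook_set l h.
Proof.
have row0 j : j < a ->
    step_right l j + hook_length (a :: l) 0 j = a + size l.
  move=> lt_ja; rewrite /hook_length /arm /leg /step_right /= drop0.
  rewrite -(count_predC (fun r => r <= j) l).
  by rewrite (@eq_count _ (predC _) (fun r => j < r)) => [|r /=]; lia.
split=> [[[|i] [j [ij ->]]]|[[j lt_ja eq_h]|[i [j [ij ->]]]]].
- by left; exists j; rewrite ?row0.
- by right; exists i, j.
- by exists 0, j; split=> //; have := row0 j lt_ja; lia.
- by exists i.+1, j.
Qed.

Lemma hook_setP la h : sorted geq la ->
  hook_set la h <->
  exists u, [/\ u \notin beta la, u + h \in beta la & 0 < h].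
Proof.
elim: la => [|a l IHl] pal; first by split=> [[i [j []]]|[u []]] //; rewrite /in_diagram nth_nil.
have sl := path_sorted pal; rewrite hook_set_cons (IHl sl) /=.
split=> [[[j lt_ja eq_h]|[u [nu uh h_gt0]]]|[u []]].
- have lt_u := step_right_small l lt_ja.
  exists (step_right l j); rewrite !inE eq_h eqxx negb_or (ltn_eqF lt_u) /=.
  by split=> //; [apply/(notin_betaP _ sl); exists j | lia].
- exists u; rewrite !inE negb_or nu uh orbT andbT; split=> //.
  by have := beta_lt pal uh; lia.
rewrite !inE negb_or => /andP[_ nu] /orP[/eqP eq_uh|uh] h_gt0; last by right; exists u.
left; have /(notin_betaP _ sl)[j def_u] := nu; exists j; last by rewrite -def_u.
rewrite ltnNge; apply/negP=> le_aj; move: eq_uh.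
by rewrite def_u (step_right_large pal le_aj) => eq_jh; lia.
Qed.

(** The length of a row is the number of steps right that precede its up-step:
    for the first row, [a + size l] steps come before, of which [size l] go up. *)
Lemma sumn_beta la : sorted geq la ->
  \sum_(x <- beta la) count (fun u => u \notin beta la) (iota 0 x) = sumn la.
Proof.
elim: la => [|a l IHl] pal /=; first by rewrite big_nil.
have sl := path_sorted pal; rewrite big_cons -(IHl sl).
have count_l x : x <= a + size l ->
    count (fun u => u \notin a + size l :: beta l) (iota 0 x) =
    count (fun u => u \notin beta l) (iota 0 x).
  move=> le_x; apply: eq_in_count => u; rewrite mem_iota inE negb_or => lt_ux.
  by rewrite neq_ltn (leq_trans _ le_x).
congr (_ + _); last first.
  rewrite big_seq [RHS]big_seq; apply: eq_bigr => x /(beta_lt pal) lt_x.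
  exact/count_l/ltnW.
have size_l : count (mem (beta l)) (iota 0 (a + size l)) = size l.
  rewrite -size_filter -[RHS]size_beta; apply/perm_size/uniq_perm.
  - exact/filter_uniq/iota_uniq.
  - exact: beta_uniq.
  move=> x; rewrite mem_filter mem_iota /= add0n.
  by case: (boolP (x \in beta l)) => //= /(beta_lt pal) ->.
rewrite count_l //; have := count_predC (mem (beta l)) (iota 0 (a + size l)).
by rewrite size_l size_iota addnC => /addIn.
Qed.

(** * From partitions to numerical sets *)

Lemma sum_uniq_iota (B : seq nat) (f : nat -> nat) K : uniq B ->
    (forall x, x \in B -> x < K) ->
  \sum_(x <- B) f x = \sum_(x <- iota 0 K | x \in B) f x.
Proof.
move=> uB ltB; rewrite -[RHS]big_filter; apply/perm_big/uniq_perm => //.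
  exact/filter_uniq/iota_uniq.
move=> x; rewrite mem_filter mem_iota /= add0n.
by case: (boolP (x \in B)) => // /ltB ->.
Qed.

Lemma psize_cells la F : sorted geq la ->
    (forall x, x \in beta la -> x <= F) ->
  psize la = #|cells F (fun u => u \notin beta la)|.
Proof.
move=> sla leF; rewrite /psize -(sumn_beta sla) (@sum_uniq_iota _ _ F.+1 (beta_uniq sla))//.
rewrite -sum_gaps_cells; by apply: eq_bigl => x; rewrite negbK.
Qed.

Lemma psize_enumeration (S : set nat) F : finite_set (~` S)%classic ->
    (forall x, ~ S x -> x <= F) ->
  psize (enumeration S) = #|cells F (fun u => u \in S)|.
Proof.
move=> finS leF; rewrite /psize /enumeration sumnE big_map.
have gapE x : (x \in fset_set (~` S)%classic) = (x \notin S).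
  by rewrite in_fset_set // in_setC.
rewrite (@sum_uniq_iota _ (fun x => count (fun u => u \in S) (iota 0 x)) F.+1).
- rewrite -sum_gaps_cells; apply: eq_bigl => x.
  by rewrite mem_sort gapE.
- by rewrite sort_uniq fset_uniq.
- by move=> x; rewrite mem_sort gapE => /negP; rewrite in_setE => /leF.
Qed.

(** The hook lengths are the [n > 0] for which some [u] in [T] has [u + n] outside
    [T], which are exactly the [n] that do not stabilize [T]. *)
Lemma beta_associated (S : set nat) la : is_partition la ->
    hook_set la = (~` S)%classic ->
  associated (fun u => u \in S) (fun u => u \notin beta la).
Proof.
move=> /andP[sla la_gt0] hookE; split; first exact: beta_gt0.
move=> n; have := hook_setP n sla; rewrite hookE => hookP.
split=> [/set_mem Sn t nt|stab].
  apply/negP=> tn; have [n0|n_gt0] := posnP n.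
    by rewrite n0 addn0 (negPf nt) in tn.
  by apply: (iffRL hookP) Sn; exists t.
apply/mem_set; apply: contrapT => nSn; have [u [nu un _]] := iffLR hookP nSn.
by have := stab u nu; rewrite un.
Qed.

Lemma frobenius_exists (S : set nat) : finite_set (~` S)%classic ->
  (exists x, ~ S x) -> exists2 F, ~ S F & forall x, F < x -> S x.
Proof.
move=> finS [y nSy].
have gapE x : (x \in fset_set (~` S)%classic) = (x \notin S).
  by rewrite in_fset_set // in_setC.
have exgap : exists x, x \notin S by exists y; apply/negP; rewrite in_setE.
have le_max x : x \notin S -> x <= \max_(z <- fset_set (~` S)%classic) z.
  by rewrite -gapE => xS; exact: (@leq_bigmax_seq _ _ xpredT id).
case: (ex_maxnP exgap le_max) => F nSF maxF; exists F.
  by move/mem_set; rewrite (negPf nSF).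
move=> x ltFx; apply/set_mem; apply: contraTT ltFx => /maxF.
by rewrite -leqNgt.
Qed.

Theorem theorem1p8 (S : set nat) (hS : numerical_semigroup S)
    (ht : semigroup_type S = 3) : lambda_minimal S.
Proof.
have [[S0 finS] SD] := hS.
have PFP z : pseudo_frobenius S z <-> pseudoFrob (fun u => u \in S) z.
  split=> [[nSz PFz]|[nSz PFz]]; split.
  - by apply/negP; rewrite in_setE.
  - by move=> s /set_mem Ss /(PFz s Ss) /mem_set.
  - by move/mem_set; rewrite (negPf nSz).
  - by move=> s /mem_set Ss /(PFz s Ss) /set_mem.
have finPF : finite_set (pseudo_frobenius S).
  by apply: sub_finite_set finS => z [].
have [z0 PFz0] : exists z, pseudo_frobenius S z.
  apply: contrapT => nex; move: ht; rewrite /semigroup_type.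
  suff -> : pseudo_frobenius S = set0 by rewrite fset_set0 cardfs0.
  by rewrite -subset0 => z PFz; apply: nex; exists z.
have [F nSF S_gtF] := frobenius_exists finS (ex_intro _ z0 PFz0.1).
have leF x : ~ S x -> x <= F by move=> nSx; rewrite leqNgt; apply/negP=> /S_gtF.
have PFF : F \in fset_set (pseudo_frobenius S).
  rewrite in_fset_set //; apply/mem_set; split=> // s _ s_neq0; apply: S_gtF; lia.
move: ht; rewrite /semigroup_type (cardfsD1 F) PFF => -[].
case defPF: (enum_fset _) => [|p [|q []]] // _.
have PFpq z : pseudoFrob (fun u => u \in S) z -> [\/ z = p, z = q | z = F].
  move=> /PFP/mem_set; rewrite -(in_fset_set finPF) => PFz.
  have [->|neq_zF] := eqVneq z F; first by constructor 3.
  have : z \in (fset_set (pseudo_frobenius S) `\ F)%fset by rewrite !inE neq_zF.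
  by rewrite -[_ \in _]/(z \in enum_fset _) defPF !inE => /orP[]/eqP->; [constructor 1 | constructor 2].
move=> la [par_la hookE]; have /andP[sla la_gt0] := par_la.
have assoc := beta_associated par_la hookE.
have Sb0 : 0 \in S by apply/mem_set.
have SbD a b : a \in S -> b \in S -> a + b \in S.
  by move=> /set_mem Sa /set_mem Sb; apply/mem_set/SD.
have SbF : F \notin S by apply/negP; rewrite in_setE.
have Sb_gtF x : F < x -> x \in S by move=> /S_gtF/mem_set.
rewrite (psize_enumeration finS leF) (@psize_cells _ F) //.
  exact: (cells_le_of_type3 Sb0 SbD SbF Sb_gtF assoc PFpq).
move=> x xB; rewrite leqNgt; apply/negP=> /Sb_gtF Sx.
by have := assoc_sub assoc Sx; rewrite xB.
Qed.
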